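(* Let $n\ge 0$ and assume the generic conditions. Then for all $x,y$ the reproducing kernel $K^{0,0}_n(x,y)=\sum_{l=0}^n P_l(x)Q_l(y)$ satisfies $$(x+y)K^{0,0}_{n}(x,y) = \hat{P}_{n}(x)\check{Q}_{n}(y) + \frac{S_{n}}{S_{n+1}}\left[ P_{n}(x)Q_{n+1}(y)+P_{n+1}(x)Q_{n}(y) \right].$$
   Context: Let $w_1,w_2$ be densities supported on $S_1,S_2\subset\mathbb R_+$, and $\langle f,g\rangle=\int_{S_1\times S_2}\frac{w_1(x)w_2(y)}{x+y}f(x)g(y)\,dx\,dy$ for polynomials $f,g$. Put $M_{j,k}=\langle x^j,y^k\rangle$, $Z_0=1$, $Z_n=\det(M_{j,k})_{0\le j,k\le n-1}$. The bi-orthogonal polynomials $P_n(x),Q_n(y)$ ($n\ge0$) have exact degree $n$, the same leading coefficient $S_n$ (so $S_n^2=Z_n/Z_{n+1}$), and $\langle P_m,Q_n\rangle=\delta_{m,n}$. Put $\pi_n=\int_{S_1}w_1(x)P_n(x)\,dx$, $\eta_n=\int_{S_2}w_2(y)Q_n(y)\,dy$, and define the intertwined polynomials $\hat P_n(x)=-\sum_{k=0}^n\eta_kP_k(x)$, $\check Q_n(y)=-\sum_{j=0}^n\pi_jQ_j(y)$. Generic conditions: all $M_{j,k}$ finite (and the univariate moments of $w_1,w_2$ finite), $Z_n\ne0$ and $\pi_n,\eta_n\neq 0$ for all $n\ge0$. *)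

(* Defs.v *)
From HB Require Import structures.
From mathcomp Require Import all_boot all_order all_algebra.
From mathcomp Require Import all_classical all_reals all_analysis.

Set Implicit Arguments.
Unset Strict Implicit.
Unset Printing Implicit Defensive.

Import Order.TTheory GRing.Theory Num.Theory.
Import numFieldNormedType.Exports.

Local Open Scope classical_set_scope.
Local Open Scope ring_scope.

Section CauchyBiorthogonal.
Variable R : realType.
Local Notation mu := (@lebesgue_measure R).

(* The sign of w is left unconstrained: nonnegative densities are a special
   case. *)
Definition density_on (S : set R) (w : R -> R) : Prop :=
  [/\ measurable S,
      S `<=` [set x | 0 <= x],
      measurable_fun [set: R] w &
      forall x, ~ S x -> w x = 0].

Variables (S1 S2 : set R) (w1 w2 : R -> R).

(* MathComp's convention 0^-1 = 0 only affects the null set {(0, 0)}. *)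
Definition cauchy_integrand (f g : {poly R}) (z : R * R) : R :=
  w1 z.1 * w2 z.2 / (z.1 + z.2) * f.[z.1] * g.[z.2].

Definition cauchy_form (f g : {poly R}) : R :=
  \int[(mu \x mu)%E]_(z in S1 `*` S2) cauchy_integrand f g z.

Definition bimoment (j k : nat) : R := cauchy_form 'X^j 'X^k.

Definition bimoment_det (n : nat) : R :=
  \det (\matrix_(j < n, k < n) bimoment j k).

(* [lead_coef (P n)], also equal to [lead_coef (Q n)], is the coefficient
   written S_n in the literature. *)
Definition biorthogonal (P Q : nat -> {poly R}) : Prop :=
  [/\ forall n, size (P n) = n.+1,
      forall n, size (Q n) = n.+1,
      forall n, lead_coef (P n) = lead_coef (Q n) &
      forall m n, cauchy_form (P m) (Q n) = (m == n)%:R].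

Definition poly_mean (S : set R) (w : R -> R) (p : {poly R}) : R :=
  \int[mu]_(x in S) (w x * p.[x]).

Definition moments_finite (S : set R) (w : R -> R) : Prop :=
  forall j : nat, mu.-integrable S (fun x => (w x * x ^+ j)%:E).

Definition bimoments_finite : Prop :=
  forall j k : nat,
    (mu \x mu)%E.-integrable (S1 `*` S2)
      (fun z => (cauchy_integrand 'X^j 'X^k z)%:E).

Definition generic (P Q : nat -> {poly R}) : Prop :=
  [/\ bimoments_finite,
      moments_finite S1 w1 /\ moments_finite S2 w2,
      forall n, bimoment_det n != 0,
      forall n, poly_mean S1 w1 (P n) != 0 &
      forall n, poly_mean S2 w2 (Q n) != 0].

Definition hatP (P Q : nat -> {poly R}) (n : nat) : {poly R} :=
  - \sum_(k < n.+1) poly_mean S2 w2 (Q k) *: P k.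

Definition checkQ (P Q : nat -> {poly R}) (n : nat) : {poly R} :=
  - \sum_(j < n.+1) poly_mean S1 w1 (P j) *: Q j.

End CauchyBiorthogonal.

Definition kernel00 (R : realType) (P Q : nat -> {poly R}) (n : nat) (x y : R)
    : R :=
  \sum_(l < n.+1) (P l).[x] * (Q l).[y].

(* Main.v *)
Require Import Defs.
From HB Require Import structures.
From mathcomp Require Import all_boot all_order all_algebra.
From mathcomp Require Import all_classical all_reals all_analysis.
From mathcomp Require Import measurable_realfun ring.
Import Order.TTheory GRing.Theory Num.Theory.
Import numFieldNormedType.Exports.
Local Open Scope classical_set_scope.
Local Open Scope ring_scope.

(* In the expansions x P_l = sum_k X_lk P_k and y Q_k = sum_l Y_kl Q_l, the
   coefficients are X_lk = <x P_l, Q_k> and Y_kl = <P_l, y Q_k>. The factor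
   x + y cancels the Cauchy kernel, so Fubini gives X_lk + Y_kl = pi_l eta_k:
   the sum over k, l <= n is the product of the intertwined polynomials, and
   only the two terms of index n + 1, both with coefficient S_n / S_(n+1),
   remain. *)

Set Implicit Arguments.
Unset Strict Implicit.

(** * Expansion in a polynomial family with one member of each degree *)

Section GradedBasis.
Variables (F : fieldType) (P : nat -> {poly F}).
Hypothesis szP : forall n, size (P n) = n.+1.

Lemma lead_coef_graded n : lead_coef (P n) = (P n)`_n.
Proof. by rewrite lead_coefE szP. Qed.

Lemma lead_coef_graded_neq0 n : lead_coef (P n) != 0.
Proof. by rewrite lead_coef_eq0 -size_poly_eq0 szP. Qed.

(** Triangularity: the multiple of [P n] that cancels the coefficient of index [n] lowers the size,
    and induction handles the remainder. *)
Lemma graded_span n (p : {poly F}) : (size p <= n)%N ->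
  exists c : nat -> F, p = \sum_(k < n) c k *: P k.
Proof.
elim: n p => [|n IH] p szp.
  by exists (fun=> 0); rewrite big_ord0; apply/eqP; rewrite -size_poly_leq0.
pose a := p`_n / lead_coef (P n).
have /IH[c pE] : (size (p - a *: P n)%R <= n)%N.
  apply/leq_sizeP => j; rewrite leq_eqVlt => /predU1P[<-|nj].
    rewrite coefB coefZ -lead_coef_graded divfK ?subrr//.
    exact: lead_coef_graded_neq0.
  rewrite coefB coefZ !nth_default ?mulr0 ?subr0 ?szP//.
  exact: leq_trans szp nj.
exists (fun k => if k == n then a else c k); rewrite big_ord_recr /= eqxx.
rewrite -[LHS](subrK (a *: P n)) pE; congr (_ + _); apply: eq_bigr => i _.
by rewrite ltn_eqF.
Qed.

(** [L k] models pairing with the k-th member of a dual family. It is kept abstract so that one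
    argument serves both sides: [B^~ (Q k)] for the family [P], and [B (P k)] for the family [Q]. *)
Variable L : nat -> {poly F} -> F.
Hypothesis linL : forall k, scalar (L k).
Hypothesis dualL : forall j k, L k (P j) = (j == k)%:R.

Lemma graded_dual_coord n (c : nat -> F) k : (k < n)%N ->
  L k (\sum_(j < n) c j *: P j) = c k.
Proof.
have L0 : L k 0 = 0.
  by have := linL k (-1) 0 0; rewrite scaler0 addr0 mulN1r addNr.
have -> : L k (\sum_(j < n) c j *: P j) = \sum_(j < n) c j * L k (P j).
  elim/big_rec2: _ => [|j u v _ <-]; first exact: L0.
  exact: linL.
move=> kn; rewrite (bigD1 (Ordinal kn)) //= dualL eqxx mulr1 big1 ?addr0// => j.
by rewrite -val_eqE dualL /= => /negPf ->; rewrite mulr0.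
Qed.

Lemma graded_dual_expansion n (p : {poly F}) : (size p <= n)%N ->
  p = \sum_(k < n) L k p *: P k.
Proof.
move=> /graded_span[c pE]; rewrite [LHS]pE; apply: eq_bigr => k _.
by rewrite pE graded_dual_coord.
Qed.

(** Compare coefficients of index [m.+1] in the expansion of ['X * P m]: the product carries the
    leading coefficient of [P m], and among the basis elements only [P m.+1] reaches that degree. *)
Lemma graded_dual_mulX m :
  L m.+1 ('X * P m) = lead_coef (P m) / lead_coef (P m.+1).
Proof.
have szXP : (size ('X * P m)%R <= m.+2)%N.
  by rewrite mulrC size_mulX ?szP// -size_poly_eq0 szP.
have := congr1 (fun p : {poly F} => p`_m.+1) (graded_dual_expansion szXP).
rewrite coefXM /= -lead_coef_graded => ->.
rewrite coef_sum big_ord_recr /= big1 ?add0r => [|i _].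
  by rewrite coefZ -lead_coef_graded mulfK// lead_coef_graded_neq0.
by rewrite coefZ nth_default ?mulr0// szP.
Qed.

(** Since ['X * P l] has degree [l + 1], cutting the expansion at index [n] loses something only for
    [l = n], namely the term in [P n.+1]. For smaller [l] the sum may run past [l + 1], as the extra
    coefficients vanish. *)
Lemma graded_mulX_horner n l x : (l <= n)%N ->
  x * (P l).[x] = \sum_(k < n.+1) L k ('X * P l) * (P k).[x] +
    (l == n)%:R * (lead_coef (P n) / lead_coef (P n.+1)) * (P n.+1).[x].
Proof.
have xPE m : (size ('X * P l)%R <= m)%N ->
    x * (P l).[x] = \sum_(k < m) L k ('X * P l) * (P k).[x].
  move=> /graded_dual_expansion/(congr1 (horner^~ x)) /=.
  rewrite hornerM hornerX horner_sum => ->.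
  by apply: eq_bigr => k _; rewrite hornerZ.
have szXP : size ('X * P l) = l.+2.
  by rewrite mulrC size_mulX ?szP// -size_poly_eq0 szP.
rewrite leq_eqVlt => /predU1P[<-|ln].
  by rewrite eqxx mul1r (xPE l.+2) ?szXP// big_ord_recr /= graded_dual_mulX.
by rewrite ltn_eqF// !mul0r addr0; apply: xPE; rewrite szXP.
Qed.

End GradedBasis.

(** * Christoffel-Darboux identity for an abstract bilinear form *)

Lemma rank_one_christoffel_darboux (F : fieldType)
    (B : {poly F} -> {poly F} -> F) (a b : {poly F} -> F)
    (P Q : nat -> {poly F}) :
  (forall q, scalar (B^~ q)) -> (forall p, scalar (B p)) ->
  (forall p q, B ('X * p) q + B p ('X * q) = a p * b q) ->
  (forall n, size (P n) = n.+1) -> (forall n, size (Q n) = n.+1) ->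
  (forall n, lead_coef (P n) = lead_coef (Q n)) ->
  (forall m n, B (P m) (Q n) = (m == n)%:R) ->
  forall n x y,
  (x + y) * (\sum_(l < n.+1) (P l).[x] * (Q l).[y]) =
  (\sum_(k < n.+1) b (Q k) * (P k).[x]) * (\sum_(l < n.+1) a (P l) * (Q l).[y])
  + lead_coef (P n) / lead_coef (P n.+1)
    * ((P n).[x] * (Q n.+1).[y] + (P n.+1).[x] * (Q n).[y]).
Proof.
move=> linl linr BX szP szQ lPQ BPQ n x y.
pose r := lead_coef (P n) / lead_coef (P n.+1).
(* Both multiplication rules are cut at the same [n], so their coefficients form square arrays that
   can be added entrywise. *)
have xP l : (l <= n)%N -> x * (P l).[x] =
    \sum_(k < n.+1) B ('X * P l) (Q k) * (P k).[x] +
    (l == n)%:R * r * (P n.+1).[x].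
  by apply: (@graded_mulX_horner F P szP (fun k => B^~ (Q k))).
have yQ l : (l <= n)%N -> y * (Q l).[y] =
    \sum_(k < n.+1) B (P k) ('X * Q l) * (Q k).[y] +
    (l == n)%:R * r * (Q n.+1).[y].
  (* Equal leading coefficients make the overflow ratio for [Q] the same [r] as for [P]. *)
  rewrite /r !lPQ; apply: (@graded_mulX_horner F Q szQ (fun k => B (P k))) => //.
  by move=> j k; rewrite BPQ eq_sym.
transitivity (\sum_(l < n.+1)
   ((x * (P l).[x]) * (Q l).[y] + (P l).[x] * (y * (Q l).[y]))).
  by rewrite mulr_sumr; apply: eq_bigr => l _; ring.
have boundary (h : nat -> F) c d :
    \sum_(l < n.+1) (l == n :> nat)%:R * c * d * h l = c * d * h n.
  rewrite big_ord_recr /= eqxx big1 ?add0r ?mul1r// => i _.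
  by rewrite ltn_eqF// !mul0r.
(* Swapping the indices in the [Q] expansion puts both coefficients in front of the same product of
   [P k] at [x] and [Q l] at [y], where their sum has rank one. *)
transitivity (\sum_(l < n.+1) \sum_(k < n.+1)
     (B ('X * P l) (Q k) + B (P l) ('X * Q k)) * ((P k).[x] * (Q l).[y]) +
   (\sum_(l < n.+1) (l == n :> nat)%:R * r * (P n.+1).[x] * (Q l).[y] +
    \sum_(l < n.+1) (l == n :> nat)%:R * r * (Q n.+1).[y] * (P l).[x])).
  have bulk : \sum_(l < n.+1) \sum_(k < n.+1)
        (B ('X * P l) (Q k) + B (P l) ('X * Q k)) * ((P k).[x] * (Q l).[y]) =
      \sum_(l < n.+1) \sum_(k < n.+1)
        B ('X * P l) (Q k) * ((P k).[x] * (Q l).[y]) +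
      \sum_(l < n.+1) \sum_(k < n.+1)
        B (P k) ('X * Q l) * ((P l).[x] * (Q k).[y]).
    rewrite [X in _ = _ + X]exchange_big -big_split; apply: eq_bigr => l _.
    by rewrite -big_split; apply: eq_bigr => k _; rewrite mulrDl.
  rewrite bulk addrACA -!big_split; apply: eq_bigr => l _ /=.
  rewrite xP 1?yQ -1?ltnS// mulrDl mulrDr mulr_suml mulr_sumr; congr (_ + _).
    by congr (_ + _); apply: eq_bigr => k _; rewrite mulrA.
  by congr (_ + _); [apply: eq_bigr => k _|]; ring.
rewrite (boundary (fun l => (Q l).[y])) (boundary (fun l => (P l).[x])).
congr (_ + _); last by rewrite /r; ring.
rewrite mulr_suml exchange_big; apply: eq_bigr => k _; rewrite mulr_sumr.
by apply: eq_bigr => l _; rewrite BX; ring.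
Qed.

(** * Integrals of products of functions in separate variables *)

Section ProductOfFunctions.
Context d1 d2 (T1 : measurableType d1) (T2 : measurableType d2) (R : realType).
Variable m1 : {sigma_finite_measure set T1 -> \bar R}.
Variable m2 : {sigma_finite_measure set T2 -> \bar R}.

(** Tonelli: the iterated integral of the absolute value is the product of the two finite L1
    norms. *)
Lemma integrable_tensor (f : T1 -> R) (g : T2 -> R) :
  m1.-integrable setT (EFin \o f) -> m2.-integrable setT (EFin \o g) ->
  (m1 \x m2)%E.-integrable setT (fun z => (f z.1 * g z.2)%:E).
Proof.
move=> intf intg.
have mf : measurable_fun setT f by apply/measurable_EFinP/(measurable_int m1).
have mg : measurable_fun setT g by apply/measurable_EFinP/(measurable_int m2).
have /integrableP[_ foo] := intf; have /integrableP[_ goo] := intg.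
apply/integrable12ltyP.
  apply/measurable_EFinP/measurable_funM.
    exact: measurableT_comp mf measurable_fst.
  exact: measurableT_comp mg measurable_snd.
have g_ge0 : (0 <= \int[m2]_y `|g y|%:E)%E by exact: integral_ge0.
have gfin : (\int[m2]_y `|g y|%:E)%E \is a fin_num by rewrite ge0_fin_numE.
rewrite (eq_integral (fun x => (\int[m2]_y `|g y|%:E) * `|f x|%:E)%E).
  rewrite ge0_integralZl//; first exact: lte_mul_pinfty.
  by apply/measurable_EFinP; exact: measurableT_comp.
move=> x _; rewrite muleC -ge0_integralZl//.
  by apply: eq_integral => y _; rewrite abse_EFin normrM EFinM.
by apply/measurable_EFinP; exact: measurableT_comp.
Qed.

Lemma Rintegral_tensor (A : set T1) (B : set T2) (f : T1 -> R) (g : T2 -> R) :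
  measurable A -> measurable B ->
  m1.-integrable A (EFin \o f) -> m2.-integrable B (EFin \o g) ->
  (m1 \x m2)%E.-integrable (A `*` B) (fun z => (f z.1 * g z.2)%:E) /\
  \int[(m1 \x m2)%E]_(z in A `*` B) (f z.1 * g z.2) =
  (\int[m1]_(x in A) f x) * (\int[m2]_(y in B) g y).
Proof.
move=> mA mB /integrable_mkcond-/(_ mA); rewrite restrict_EFin => intf.
move=> /integrable_mkcond-/(_ mB); rewrite restrict_EFin => intg.
(* Extension by zero respects products on a rectangle, which reduces the claim to the whole space,
   where Fubini applies. *)
have fgE : (fun z : T1 * T2 => f z.1 * g z.2) \_ (A `*` B) =
    (fun z => (f \_ A) z.1 * (g \_ B) z.2).
  apply/funext => -[x y]; rewrite !patchE in_setX /=.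
  by case: (x \in A); case: (y \in B); rewrite ?mul0r ?mulr0.
have intfg := integrable_tensor intf intg; split.
  apply/integrable_mkcond; first exact: measurableX.
  by rewrite (restrict_EFin (fun z => f z.1 * g z.2)) fgE.
rewrite Rintegral_mkcond fgE (Rintegral_mkcond m1) (Rintegral_mkcond m2).
rewrite {1}/Rintegral -integral12_prod_meas1//.
rewrite mulrC -RintegralZl//.
congr fine; apply: eq_integral => x _; rewrite /fubini_F /=.
under eq_integral do rewrite EFinM.
rewrite integralZl//= EFinM muleC fineK//.
exact: integrable_fin_num.
Qed.

End ProductOfFunctions.

(** * Bilinearity of the Cauchy form and its multiplication rule *)

Section CauchyForm.
Variables (R : realType) (S1 S2 : set R) (w1 w2 : R -> R).
Local Notation mu := (@lebesgue_measure R).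
Local Notation form := (cauchy_form S1 S2 w1 w2).
Local Notation integrand := (cauchy_integrand w1 w2).
Hypothesis mS1 : measurable S1.
Hypothesis mS2 : measurable S2.

Lemma integrable_mulr_poly (S : set R) (w : R -> R) (p : {poly R}) :
  measurable S -> moments_finite S w ->
  mu.-integrable S (EFin \o (fun x => w x * p.[x])).
Proof.
move=> mS mom.
have -> : EFin \o (fun x => w x * p.[x]) =
    (fun x => \sum_(i < size p) (p`_i)%:E * (w x * x ^+ i)%:E)%E.
  apply/funext => x /=; rewrite horner_coef mulr_sumr -sumEFin.
  by apply: eq_bigr => i _; rewrite -EFinM mulrCA.
by apply: integrable_sum => // i _; exact: integrableZl.
Qed.

Hypothesis bimom : bimoments_finite S1 S2 w1 w2.

Let mS : measurable (S1 `*` S2). Proof. exact: measurableX. Qed.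

(** Expanding [f] and [g] in monomials gives a finite combination of the bimoment integrands. *)
Lemma integrable_cauchy_integrand (f g : {poly R}) :
  (mu \x mu)%E.-integrable (S1 `*` S2) (EFin \o integrand f g).
Proof.
have -> : EFin \o integrand f g =
  (fun z => \sum_(i < size f) \sum_(j < size g)
    (f`_i * g`_j)%:E * (integrand 'X^i 'X^j z)%:E)%E.
  apply/funext => z; rewrite /= /cauchy_integrand.
  rewrite (horner_coef f) mulr_sumr mulr_suml -sumEFin.
  apply: eq_bigr => i _; rewrite (horner_coef g) mulr_sumr -sumEFin.
  apply: eq_bigr => j _.
  by rewrite -EFinM !hornerXn; congr EFin; ring.
apply: integrable_sum => // i _; apply: integrable_sum => // j _.
exact: integrableZl.
Qed.

Lemma cauchy_form_scalarl g : scalar (form^~ g).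
Proof.
move=> a f h; rewrite /cauchy_form -RintegralZl//; last first.
  exact: integrable_cauchy_integrand.
rewrite -RintegralD//; last exact: integrable_cauchy_integrand.
  apply: eq_Rintegral => z _.
  by rewrite /cauchy_integrand hornerD hornerZ; ring.
by apply: (integrableZl _ a (integrable_cauchy_integrand f g)).
Qed.

Lemma cauchy_form_scalarr f : scalar (form f).
Proof.
move=> a g h; rewrite /cauchy_form -RintegralZl//; last first.
  exact: integrable_cauchy_integrand.
rewrite -RintegralD//; last exact: integrable_cauchy_integrand.
  apply: eq_Rintegral => z _.
  by rewrite /cauchy_integrand hornerD hornerZ; ring.
by apply: (integrableZl _ a (integrable_cauchy_integrand f g)).
Qed.

(** Adding the integrands produces a factor [x + y] that cancels the denominator away from the
    origin, leaving a product of functions of [x] and of [y]. *)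
Lemma cauchy_form_mulX (f g : {poly R}) :
  S1 `<=` [set x | 0 <= x] -> S2 `<=` [set y | 0 <= y] ->
  moments_finite S1 w1 -> moments_finite S2 w2 ->
  form ('X * f) g + form f ('X * g) =
  poly_mean S1 w1 f * poly_mean S2 w2 g.
Proof.
move=> S1pos S2pos mom1 mom2.
have intXf := integrable_cauchy_integrand ('X * f) g.
have intXg := integrable_cauchy_integrand f ('X * g).
have [//|//|intfg <-] := Rintegral_tensor _ _ (integrable_mulr_poly f mS1 mom1)
  (integrable_mulr_poly g mS2 mom2).
rewrite /cauchy_form -RintegralD//; congr fine.
apply: ae_eq_integral => //.
- by apply: measurable_int; apply: integrableD intXf intXg.
- exact: measurable_int intfg.
(* The exceptional set is the origin, written as a rectangle so that its product measure is computed
   from the factors. *)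
exists ([set 0] `*` [set 0]); split.
- by apply: measurableX; exact: measurable_set1.
- rewrite [LHS]product_measure1E; [|exact: measurable_set1..].
  by rewrite [X in (X * _)%E]lebesgue_measure_set1 mul0e.
move=> [x y] /= /not_implyP[[Sx Sy]] neq; apply: contrapT => xy0; apply: neq.
(* Both coordinates are nonnegative on the supports, so their sum vanishes only at the origin. *)
have xy_neq0 : x + y != 0.
  rewrite paddr_eq0; [|exact: S1pos Sx|exact: S2pos Sy].
  by apply/negP => /andP[/eqP x0 /eqP y0]; exact: xy0.
rewrite /cauchy_integrand /= !hornerM !hornerX; congr EFin.
by field.
Qed.

End CauchyForm.

Unset Implicit Arguments.
Set Strict Implicit.

Theorem proposition3p7 (R : realType) (S1 S2 : set R) (w1 w2 : R -> R)
    (hw1 : density_on S1 w1) (hw2 : density_on S2 w2)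
    (P Q : nat -> {poly R})
    (hPQ : biorthogonal S1 S2 w1 w2 P Q)
    (hgen : generic S1 S2 w1 w2 P Q)
    (n : nat) (x y : R) :
  (x + y) * kernel00 P Q n x y =
    (hatP S2 w2 P Q n).[x] * (checkQ S1 w1 P Q n).[y]
    + lead_coef (P n) / lead_coef (P n.+1)
      * ((P n).[x] * (Q n.+1).[y] + (P n.+1).[x] * (Q n).[y]).
Proof.
have [mS1 S1pos _ _] := hw1; have [mS2 S2pos _ _] := hw2.
have [szP szQ lPQ PQ] := hPQ.
have [bimom [mom1 mom2] _ _ _] := hgen.
rewrite /kernel00 (rank_one_christoffel_darboux
  (cauchy_form_scalarl mS1 mS2 bimom) (cauchy_form_scalarr mS1 mS2 bimom)
  (fun p q => cauchy_form_mulX mS1 mS2 bimom p q S1pos S2pos mom1 mom2)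
  szP szQ lPQ PQ).
(* The minus signs of the two intertwined polynomials cancel in their product. *)
rewrite /hatP /checkQ !hornerN mulrNN !horner_sum.
by congr (_ * _ + _); apply: eq_bigr => k _; rewrite hornerZ.
Qed.
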